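(* Let $G$ be a finite simple graph and let $m$ be a positive integer. Then $c(\mathsf{M}_m(G))\leq \|G\|$. Moreover, if $G$ is triangle-free, then $c(\mathsf{M}_m(G))\leq \|G\|-e_2(G)$.
   Context: Graphs are finite, without loops or multiple edges. $\|G\|$ denotes the number of edges of $G$, and $e_2(G)$ is the maximum number of edges in a $2$-colorable (i.e. bipartite) subgraph of $G$. A cover graph is the underlying undirected graph of the Hasse diagram (covering relation) of a finite partially ordered set. $c(G)=\min\{|F| : F\subseteq E(G) \text{ and } G-F \text{ is a cover graph}\}$, where $G-F$ is obtained by deleting the edges in $F$ (keeping all vertices). Generalized Mycielski graph: let $G$ have vertex set $V_0=\{\langle 0,0\rangle,\langle 0,1\rangle,\ldots,\langle 0,n-1\rangle\}$ and edge set $E_0$. For an integer $m>0$, $\mathsf{M}_m(G)$ has vertex set $V_0\cup\bigcup_{i=1}^m V_i\cup\{u\}$, where $V_i=\{\langle i,j\rangle : 0\leq j\leq n-1\}$, and edge set $E_0\cup\bigcup_{i=1}^m E_i\cup\{\langle m,j\rangle u : 0\leq j\leq n-1\}$, where $E_i=\{\langle i-1,j\rangle\langle i,k\rangle : \langle 0,j\rangle\langle 0,k\rangle\in E_0\}$ for $1\leq i\leq m$ (for each edge of $E_0$ both orders of $j,k$ are used). *)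

(* Defs.v *)
From HB Require Import structures.
From mathcomp Require Import all_boot all_order.
From mathcomp Require Import boolp.

Set Implicit Arguments.
Unset Strict Implicit.
Unset Printing Implicit Defensive.

Import Order.TTheory.

Record sgraph := SGraph {
  vertex :> finType;
  adj : rel vertex;
  adj_sym : symmetric adj;
  adj_irrefl : irreflexive adj }.

Declare Scope sgraph_scope.
Local Open Scope sgraph_scope.

Notation "x -- y" := (adj x y) (at level 30, no associativity) : sgraph_scope.

(* An edge is the two-element set of its endpoints. *)
Definition edges (G : sgraph) : {set {set G}} :=
  [set [set p.1; p.2] | p : G * G & p.1 -- p.2].

Definition num_edges (G : sgraph) : nat := #|edges G|.

Definition triangle_free (G : sgraph) : Prop :=
  forall x y z : G, ~~ [&& x -- y, y -- z & z -- x].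

Definition colorable (k : nat) (G : sgraph) : bool :=
  [exists f : {ffun G -> 'I_k}, forall x : G, forall y : G,
    (x -- y) ==> (f x != f y)].

Section DelEdges.
Variables (G : sgraph) (F : {set {set G}}).

Definition del_adj : rel G := fun x y => (x -- y) && ([set x; y] \notin F).

Lemma del_adj_sym : symmetric del_adj.
Proof. by move=> x y; rewrite /del_adj adj_sym setUC. Qed.

Lemma del_adj_irrefl : irreflexive del_adj.
Proof. by move=> x; rewrite /del_adj adj_irrefl. Qed.

Definition del_edges : sgraph := SGraph del_adj_sym del_adj_irrefl.
End DelEdges.

(* The subgraph with vertex set W whose edges are the edges of G lying inside
   W and belonging to F.  Every subgraph of G is of this form. *)
Section Subgraph.
Variables (G : sgraph) (W : {set G}) (F : {set {set G}}).

Definition sub_adj : rel {x : G | x \in W} :=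
  fun x y => (val x -- val y) && ([set val x; val y] \in F).

Lemma sub_adj_sym : symmetric sub_adj.
Proof. by move=> x y; rewrite /sub_adj adj_sym setUC. Qed.

Lemma sub_adj_irrefl : irreflexive sub_adj.
Proof. by move=> x; rewrite /sub_adj adj_irrefl. Qed.

Definition subgraph : sgraph := SGraph sub_adj_sym sub_adj_irrefl.
End Subgraph.

Definition e_ (k : nat) (G : sgraph) : nat :=
  \max_(WF : {set G} * {set {set G}} | colorable k (subgraph WF.1 WF.2))
     num_edges (subgraph WF.1 WF.2).

(* Hence the truncated subtraction num_edges G - e_ 2 G is the true difference. *)
Lemma e_leq k (G : sgraph) : e_ k G <= num_edges G.
Proof.
apply/bigmax_leqP => -[W F] _ /=; rewrite /num_edges.
rewrite -(card_imset _ (imset_inj val_inj)); apply: subset_leq_card.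
apply/subsetP => _ /imsetP[_ /imsetP[[x y] /= + ->] ->].
rewrite inE /= => /andP[xy _].
by apply/imsetP; exists (val x, val y); rewrite ?inE // imsetU1 imset_set1.
Qed.

Definition covers (d : Order.disp_t) (P : finPOrderType d) (x y : P) : bool :=
  (x < y)%O && ~~ [exists z, (x < z < y)%O].

Definition cover_graph (G : sgraph) : Prop :=
  exists (d : Order.disp_t) (P : finPOrderType d) (h : G -> P),
    bijective h /\
    forall x y : G, (x -- y) = covers (h x) (h y) || covers (h y) (h x).

Lemma rel_cover_graph (G : sgraph) (r : rel G) :
  irreflexive r -> transitive r ->
  (forall x y : G, (x -- y) =
     (r x y && ~~ [exists z, r x z && r z y]) ||
     (r y x && ~~ [exists z, r y z && r z x])) ->
  cover_graph G.
Proof.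
move=> ri rt adjE.
pose d := Order.Disp tt tt.
pose mx := Order.Lt_isPOrder.Build d (vertex G) ri rt.
pose P : finPOrderType d := HB.pack (vertex G) mx.
exists d, P, id; split; first by exists id.
have ltE (a b : P) : (a < b)%O = r a b by [].
have covE (a b : P) : covers a b = r a b && ~~ [exists z, r a z && r z b].
  rewrite /covers ltE; congr (_ && ~~ _).
  by apply/existsP/existsP => -[z hz]; exists z; move: hz; rewrite !ltE.
by move=> x y; rewrite (covE x y) (covE y x); exact: adjE.
Qed.

Definition cover_deletable (G : sgraph) (k : nat) : bool :=
  [exists F : {set {set G}},
    [&& F \subset edges G, `[< cover_graph (del_edges F) >] & #|F| == k]].

Lemma cover_deletable_ex (G : sgraph) : exists k, cover_deletable G k.
Proof.
exists #|edges G|; apply/existsP; exists (edges G); rewrite subxx eqxx andbT /=.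
apply/asboolP/(@rel_cover_graph _ (fun _ _ => false)) => //= x y.
apply/negP => /andP[xy /negP]; apply; apply/imsetP.
by exists (x, y); rewrite ?inE.
Qed.

Definition c (G : sgraph) : nat := ex_minn (cover_deletable_ex G).

(* Some (i, x) is the copy of the vertex x of G in level i, 0 <= i <= m;
   None is the additional vertex u. *)
Section Mycielski.
Variables (m : nat) (G : sgraph).

Definition myc_adj : rel (option ('I_m.+1 * G)) := fun a b =>
  match a, b with
  | Some (i, x), Some (j, y) =>
      (x -- y) && [|| (i == 0 :> nat) && (j == 0 :> nat),
                      j == i.+1 :> nat | i == j.+1 :> nat]
  | Some (i, _), None | None, Some (i, _) => i == m :> nat
  | None, None => false
  end.

Lemma myc_adj_sym : symmetric myc_adj.
Proof.
move=> [[i x]|] [[j y]|] //=; rewrite adj_sym; congr (_ && _).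
by rewrite andbC; congr (_ || _); rewrite orbC.
Qed.

Lemma myc_adj_irrefl : irreflexive myc_adj.
Proof. by move=> [[i x]|] //=; rewrite adj_irrefl. Qed.

Definition Mycielski : sgraph := SGraph myc_adj_sym myc_adj_irrefl.
End Mycielski.

(* Main.v *)
Require Import Defs.
From mathcomp Require Import all_boot all_order.
From mathcomp Require Import boolp zify.

(** Keep a bipartite set [K] of edges of level 0 and orient each remaining edge
    of the Mycielskian upwards: from the first colour class of level 0 to the
    second, then through levels 1, ..., [m] up to [u].  The orientation is
    acyclic, and an edge bypassed by a longer directed path can only join level
    0 to level 1, the path having length two with its first edge in [K]: this
    gives a triangle of [G].  Take [K] empty, or a largest bipartite
    subgraph. *)

Set Implicit Arguments.
Unset Strict Implicit.
Unset Printing Implicit Defensive.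

Local Open Scope sgraph_scope.

Lemma connect_first_step (T : finType) (o : rel T) (x y : T) :
  connect o x y -> x != y -> exists2 z, o x z & connect o z y.
Proof.
case/connectP=> [[|z p] /= + ->]; first by rewrite eqxx.
by case/andP=> xz zp _; exists z => //; apply/connectP; exists p.
Qed.

Lemma connect_rank (T : finType) (o : rel T) (h : T -> nat) :
  (forall x y, o x y -> h x < h y) ->
  forall x y, connect o x y -> h x <= h y.
Proof.
move=> oh x y /connectP[p + ->]; elim: p x => //= z p IH x /andP[/oh xz /IH].
by apply: leq_trans; apply: ltnW.
Qed.

(** The order is reachability along [o]: [h] rules out cycles, and [bypass] says that no arc is
    shortcut by a longer path, so the arcs are exactly the covering pairs. *)
Lemma oriented_cover_graph (G : sgraph) (o : rel G) (h : G -> nat) :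
  (forall x y, o x y -> h x < h y) ->
  (forall x y, (x -- y) = o x y || o y x) ->
  (forall x y z, o x y -> o x z -> connect o z y -> z = y) ->
  cover_graph G.
Proof.
move=> oh adjE bypass.
(* Since [connect] is reflexive, a first arc is forced to make the relation strict. *)
pose r x y := [exists z, o x z && connect o z y].
have rP x y : reflect (exists2 z, o x z & connect o z y) (r x y).
  apply: (iffP existsP) => [[z /andP[]]|[z xz zy]]; first by exists z.
  by exists z; rewrite xz.
have rh x y : r x y -> h x < h y.
  by case/rP=> z /oh xz /(connect_rank oh); apply: leq_trans.
have r_connect x y : r x y -> connect o x y.
  by case/rP=> z xz; apply: connect_trans; apply: connect1.
have oE x y : o x y = r x y && ~~ [exists z, r x z && r z y].
  apply/idP/andP => [xy|[/rP[z xz zy] nb]].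
    split; first by apply/rP; exists y.
    (* For [z] strictly between, [bypass] makes the first vertex [w] of the path to [z] equal to
       [y]; then [y] reaches [z], which lies strictly below [y]. *)
    apply/existsP => -[z /andP[/rP[w xw wz] zy]].
    have wy := bypass _ _ _ xy xw (connect_trans wz (r_connect _ _ zy)).
    by have := leq_ltn_trans (connect_rank oh wz) (rh _ _ zy); rewrite wy ltnn.
  case: (eqVneq z y) => [<- //|neq_zy].
  case/negP: nb; apply/existsP; exists z; apply/andP.
  split; first by apply/rP; exists z.
  by apply/rP; apply: connect_first_step zy neq_zy.
apply: (@rel_cover_graph _ r) => [x|y x z /rP[w xw wy] yz|x y].
- by case xx: (r x x) => //; have := rh _ _ xx; rewrite ltnn.
- by apply/rP; exists w => //; apply: connect_trans wy (r_connect _ _ yz).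
- by rewrite -!oE.
Qed.

Lemma c_leq (H : sgraph) (F : {set {set H}}) :
  F \subset edges H -> cover_graph (del_edges F) -> c H <= #|F|.
Proof.
move=> sF cF; rewrite /c; case: ex_minnP => k _; apply.
by apply/existsP; exists F; rewrite sF eqxx andbT; apply/asboolP.
Qed.

Section LevelZero.
Variables (G : sgraph) (m : nat).

Definition level0 (x : G) : Mycielski m G := Some (ord0, x).

Lemma level0_inj : injective level0.
Proof. by move=> x y []. Qed.

Lemma level0_edge (x y : G) (A : {set {set G}}) :
  ([set level0 x; level0 y] \in [set level0 @: e | e : {set G} in A]) =
  ([set x; y] \in A).
Proof.
have -> : [set level0 x; level0 y] = level0 @: [set x; y].
  by rewrite imsetU1 imset_set1.
by rewrite mem_imset //; apply: imset_inj level0_inj.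
Qed.

Lemma level0_edges :
  [set level0 @: e | e : {set G} in edges G] \subset edges (Mycielski m G).
Proof.
apply/subsetP => _ /imsetP[_ /imsetP[[x y] /= + ->] ->]; rewrite inE /= => xy.
apply/imsetP; exists (level0 x, level0 y); first by rewrite !inE /= xy.
by rewrite imsetU1 imset_set1.
Qed.

(** Level 0 takes up heights 0 and 1, one per colour, so the later levels shift up by one. *)
Definition height (g : G -> bool) (a : Mycielski m G) : nat :=
  match a with
  | Some (i, x) => if i == 0 :> nat then nat_of_bool (g x) else i.+1
  | None => m.+2
  end.

(** Only the level 0 copies of edges outside [K] are deleted. The last hypothesis says that no edge
    of [K] lies in a triangle. *)
Lemma c_Mycielski_leq (K : {set {set G}}) (g : G -> bool) :
  0 < m -> K \subset edges G ->
  (forall x y, [set x; y] \in K -> g x != g y) ->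
  (forall x y z, [set x; y] \in K -> y -- z -> ~~ (z -- x)) ->
  c (Mycielski m G) + #|K| <= num_edges G.
Proof.
move=> m_gt0 sKE gK triK.
pose F := [set level0 @: e | e : {set G} in edges G :\: K].
have sF : F \subset edges (Mycielski m G).
  by apply: subset_trans level0_edges; apply: imsetS; apply: subsetDl.
suff cF : cover_graph (del_edges F).
  rewrite addnC -leq_subRL ?subset_leq_card // /num_edges.
  by rewrite -cardsDS //; apply: leq_trans (c_leq sF cF) (leq_imset_card _ _).
have adjK x y : x -- y -> [set level0 x; level0 y] \notin F -> [set x; y] \in K.
  move=> xy; rewrite level0_edge inE negb_and negbK => /orP[//|/negP[]].
  by apply/imsetP; exists (x, y); rewrite ?inE.
pose o : rel (del_edges F) := fun a b => (a -- b) && (height g a < height g b).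
have oh a b : o a b -> height g a < height g b by case/andP.
(* An upward edge climbs by one, except from a vertex of height 0 to level 1, where it climbs by
   two. *)
have step (a b : del_edges F) : a -- b -> height g a < height g b ->
    height g b = (height g a).+1 \/
    exists x y, [/\ a = level0 x, x -- y, b = Some (inord 1, y) & height g b = 2].
  case/andP=> + _; case: a b => [[i x]|] [[j y]|] //=; last 2 first.
  - by case: (eqVneq (i : nat) 0); left; lia.
  - by case: (eqVneq (j : nat) 0); lia.
  case: (eqVneq (i : nat) 0) => i0; case: (eqVneq (j : nat) 0) => j0;
    try by left; lia.
  case: (g x) => /andP[xy ij] _; first by left; lia.
  right; exists x, y; split=> //; last by lia.
    by congr (Some (_, _)); apply: val_inj.
  by congr (Some (_, _)); apply: val_inj; rewrite /= inordK; lia.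
apply: (@oriented_cover_graph (del_edges F) o (height g)) => //
  [a b|a b d ab ad db].
  (* It remains to see that adjacent vertices differ in height; only two vertices of level 0 could
     tie, and [gK] separates them. *)
  rewrite /o [b -- a]adj_sym -andb_orr -neq_ltn.
  case ab: (a -- b) => //=; apply/esym/negP => /eqP.
  move: ab => /andP[].
  case: a b => [[i x]|] [[j y]|] //=; last 2 first.
  - by case: (eqVneq (i : nat) 0) => i0; lia.
  - by case: (eqVneq (j : nat) 0) => j0; lia.
  case: (eqVneq (i : nat) 0) => i0; case: (eqVneq (j : nat) 0) => j0; try lia.
  have [-> ->] : i = ord0 /\ j = ord0 by split; apply: val_inj.
  case/andP=> xy _ /(adjK _ _ xy) /gK /eqP; case: (g x) (g y) => [] [] //.
(* A bypass visits [a], [d], [w] at increasing heights, none above [b], so [a -- b] is an edge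
   climbing by two. *)
apply/eqP/negPn/negP => neq_db.
have [w dw wb] := connect_first_step db neq_db.
have [a_d d_w w_b] := And3 (oh _ _ ad) (oh _ _ dw) (connect_rank oh wb).
have [/andP[a_adj_b a_b] /andP[a_adj_d _]] := conj ab ad.
have [|[x [y [Da xy Db hb]]]] := step _ _ a_adj_b a_b; first by lia.
(* [d] has height 1, so it lies in level 0. *)
have [z Dd] : exists z, d = level0 z.
  move: d_w w_b; rewrite hb.
  case: d {db neq_db dw ad a_adj_d a_d} => [[i z]|] /=; last by lia.
  case: (eqVneq (i : nat) 0) => [i0 _ _|]; last by lia.
  by exists z; congr (Some (_, _)); apply: val_inj.
have Dw : w = b.
  apply/eqP/negPn/negP => /(connect_first_step wb)[v wv vb].
  by have [] := conj (oh _ _ wv) (connect_rank oh vb); lia.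
(* Now [x], [z], [y] form a triangle of [G] whose edge [xz] is in [K]. *)
move: dw a_adj_d; rewrite Dw Da Dd Db => /andP[/andP[/= /andP[zy _] _] _].
case/andP=> /= /andP[xz _] /(adjK _ _ xz) /triK /(_ zy).
by rewrite adj_sym xy.
Qed.
End LevelZero.

Theorem theorem17 (G : sgraph) (m : nat) (hm : 0 < m) :
  c (Mycielski m G) <= num_edges G /\
  (triangle_free G -> c (Mycielski m G) <= num_edges G - e_ 2 G).
Proof.
have c_le : c (Mycielski m G) <= num_edges G.
  rewrite -[X in X <= _]addn0 -(cards0 {set G}).
  by apply: (@c_Mycielski_leq _ _ _ (fun=> false));
    rewrite ?sub0set // => x y; rewrite inE.
(* Isolating [e_ 2 G] on the left, which is sound by [c_le], leaves a bound to prove for each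
   2-colorable subgraph. *)
split=> // tri; rewrite leq_subRL ?e_leq // addnC -leq_subRL //.
apply/bigmax_leqP => -[W S] /= /existsP[f /forallP fP].
pose H := subgraph W S.
pose K := [set val @: e | e : {set H} in edges H].
have KP x y : [set x; y] \in K ->
    exists u v : H, [/\ u -- v, x = val u & y = val v].
  case/imsetP=> _ /imsetP[[u v] /= + ->]; rewrite inE imsetU1 imset_set1 /= => uv E.
  have neq_uv : val u != val v.
    by apply: contraTneq uv => /val_inj->; apply/negbT/(@adj_irrefl H).
  move: (set21 x y) (set22 x y); rewrite E => /set2P[] Dx /set2P[] Dy.
  - case/eqP: neq_uv; have := set22 (val u) (val v).
    by rewrite -E Dx Dy => /set2P[].
  - by exists u, v.
  - exists v, u; split=> //; exact: etrans (@adj_sym H v u) uv.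
  - case/eqP: neq_uv; have := set21 (val u) (val v).
    by rewrite -E Dx Dy => /set2P[].
have <- : #|K| = num_edges H by rewrite card_imset //; apply: imset_inj val_inj.
rewrite leq_subRL //.
(* The value [false] outside [W] is harmless, as edges of [K] have both ends in [W]. *)
pose g x := if insub x is Some u then f u == ord0 else false.
apply: (@c_Mycielski_leq _ _ _ g) => //
  [|x y /KP[u [v [uv -> ->]]]|x y z /KP[u [v [uv -> ->]]]].
- apply/subsetP => _ /imsetP[_ /imsetP[[u v] /= + ->] ->]; rewrite inE => /andP[uv _].
  by apply/imsetP; exists (val u, val v); rewrite ?inE // imsetU1 imset_set1.
- rewrite /g !valK; have /forallP/(_ v)/implyP/(_ uv) := fP u.
  by case: (f u) (f v) => [[|[|?]] ?] [[|[|?]] ?].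
- by move=> vz; have := tri (val u) (val v) z; rewrite vz; case/andP: uv => -> _.
Qed.
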